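(* Let $U\subset\mathbb{R}^2$ be open, $f,g:U\to\mathbb{R}$ smooth, and let $M\subset\mathbb{R}^{3,1}$ be the timelike surface parametrized by $\psi(x,y)=(f(x,y),g(x,y),x,y)$. Assume that $M$ has a canonical null direction with respect to both $e_3$ and $e_4$. Then $M$ is minimal if and only if $M$ can be locally parametrized as $$\psi(x,y)=\alpha(x)+\beta(y),$$ where $\alpha$ and $\beta$ are lightlike curves contained in the timelike hyperplanes orthogonal to $e_4$ and to $e_3$, respectively.
   Context: $\mathbb{R}^{3,1}$ is $\mathbb{R}^{4}$ with the metric $-dx_1^2+dx_2^2+dx_3^2+dx_4^2$, and $e_1,\dots,e_4$ is its canonical basis. A surface is timelike if the induced metric has signature $(1,1)$; a vector $v$ is lightlike if $v\ne0$ and $\langle v,v\rangle=0$; a curve is lightlike if its velocity is lightlike everywhere. For a constant vector $Z$, $Z=Z^\top+Z^\perp$ along $M$; $M$ has a canonical null direction with respect to $Z$ if $Z^\top$ is lightlike everywhere on $M$. $M$ is minimal if its mean curvature vector $\frac12\operatorname{tr}II$ vanishes. *)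

(* Defs.v *)
From Stdlib Require Import Reals Lra List ClassicalEpsilon.
Open Scope R_scope.

Record V4 : Type := mkV4 { c1 : R; c2 : R; c3 : R; c4 : R }.

Definition vadd (u v : V4) : V4 :=
  mkV4 (c1 u + c1 v) (c2 u + c2 v) (c3 u + c3 v) (c4 u + c4 v).
Definition vscal (a : R) (u : V4) : V4 :=
  mkV4 (a * c1 u) (a * c2 u) (a * c3 u) (a * c4 u).
Definition vsub (u v : V4) : V4 := vadd u (vscal (-1) v).
Definition vzero : V4 := mkV4 0 0 0 0.

Definition mink (u v : V4) : R :=
  - c1 u * c1 v + c2 u * c2 v + c3 u * c3 v + c4 u * c4 v.

Definition e3 : V4 := mkV4 0 0 1 0.
Definition e4 : V4 := mkV4 0 0 0 1.

Definition lightlike (v : V4) : Prop := v <> vzero /\ mink v v = 0.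

Definition open2 (U : R -> R -> Prop) : Prop :=
  forall x y, U x y -> exists eps, 0 < eps /\
    forall x' y', Rabs (x' - x) < eps -> Rabs (y' - y) < eps -> U x' y'.

Definition cont2_on (U : R -> R -> Prop) (h : R -> R -> R) : Prop :=
  forall x y, U x y -> forall eps, 0 < eps -> exists del, 0 < del /\
    forall x' y', U x' y' -> Rabs (x' - x) < del -> Rabs (y' - y) < del ->
      Rabs (h x' y' - h x y) < eps.

(** C^infinity on U: all iterated partial derivatives exist and are continuous.
    [D w] is the iterated partial derivative along the word [w]
    (true = d/dx, false = d/dy, applied from right to left). *)
Definition smooth2 (U : R -> R -> Prop) (h : R -> R -> R) : Prop :=
  exists D : list bool -> R -> R -> R,
    (forall x y, U x y -> D nil x y = h x y) /\
    forall w, cont2_on U (D w) /\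
      forall x y, U x y ->
        derivable_pt_lim (fun t => D w t y) x (D (true :: w) x y) /\
        derivable_pt_lim (fun t => D w x t) y (D (false :: w) x y).

(** partial derivatives (the derivative value, chosen classically; unique
    wherever the partial derivative exists) *)
Definition dx (h : R -> R -> R) (x y : R) : R :=
  epsilon (inhabits 0) (fun l => derivable_pt_lim (fun t => h t y) x l).
Definition dy (h : R -> R -> R) (x y : R) : R :=
  epsilon (inhabits 0) (fun l => derivable_pt_lim (fun t => h x t) y l).

Definition dxv (p : R -> R -> V4) (x y : R) : V4 :=
  mkV4 (dx (fun a b => c1 (p a b)) x y) (dx (fun a b => c2 (p a b)) x y)
       (dx (fun a b => c3 (p a b)) x y) (dx (fun a b => c4 (p a b)) x y).
Definition dyv (p : R -> R -> V4) (x y : R) : V4 :=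
  mkV4 (dy (fun a b => c1 (p a b)) x y) (dy (fun a b => c2 (p a b)) x y)
       (dy (fun a b => c3 (p a b)) x y) (dy (fun a b => c4 (p a b)) x y).

Definition psi (f g : R -> R -> R) (x y : R) : V4 := mkV4 (f x y) (g x y) x y.

Section Surface.
Variables (f g : R -> R -> R).
Let p := psi f g.
Definition psix := dxv p.
Definition psiy := dyv p.
Definition psixx := dxv (dxv p).
Definition psixy := dxv (dyv p).
Definition psiyy := dyv (dyv p).
Definition EE x y := mink (psix x y) (psix x y).
Definition FF x y := mink (psix x y) (psiy x y).
Definition GG x y := mink (psiy x y) (psiy x y).
Definition detI x y := EE x y * GG x y - FF x y * FF x y.

Definition tproj (Z : V4) (x y : R) : V4 :=
  let zx := mink Z (psix x y) in
  let zy := mink Z (psiy x y) in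
  vadd (vscal ((GG x y * zx - FF x y * zy) / detI x y) (psix x y))
       (vscal ((EE x y * zy - FF x y * zx) / detI x y) (psiy x y)).
Definition nproj (Z : V4) (x y : R) : V4 := vsub Z (tproj Z x y).

(** mean curvature vector H = 1/2 tr II = 1/2 g^{ij} (psi_ij)^perp *)
Definition meanH (x y : R) : V4 :=
  vscal (/2)
   (vadd (vscal (GG x y / detI x y) (nproj (psixx x y) x y))
    (vadd (vscal (2 * (- FF x y / detI x y)) (nproj (psixy x y) x y))
          (vscal (EE x y / detI x y) (nproj (psiyy x y) x y)))).
End Surface.

Definition timelike_graph (U : R -> R -> Prop) (f g : R -> R -> R) : Prop :=
  forall x y, U x y -> detI f g x y < 0.

Definition canonical_null_dir (U : R -> R -> Prop) (f g : R -> R -> R) (Z : V4)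
  : Prop := forall x y, U x y -> lightlike (tproj f g Z x y).

Definition minimal (U : R -> R -> Prop) (f g : R -> R -> R) : Prop :=
  forall x y, U x y -> meanH f g x y = vzero.

Definition smooth1_on (a b : R) (h : R -> R) : Prop :=
  exists D : nat -> R -> R, (forall t, a < t < b -> D O t = h t) /\
    forall n t, a < t < b -> derivable_pt_lim (D n) t (D (S n) t).

Definition smooth_curve_on (a b : R) (al : R -> V4) : Prop :=
  smooth1_on a b (fun t => c1 (al t)) /\ smooth1_on a b (fun t => c2 (al t)) /\
  smooth1_on a b (fun t => c3 (al t)) /\ smooth1_on a b (fun t => c4 (al t)).

Definition d1 (h : R -> R) (t : R) : R :=
  epsilon (inhabits 0) (fun l => derivable_pt_lim h t l).
Definition velocity (al : R -> V4) (t : R) : V4 :=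
  mkV4 (d1 (fun s => c1 (al s)) t) (d1 (fun s => c2 (al s)) t)
       (d1 (fun s => c3 (al s)) t) (d1 (fun s => c4 (al s)) t).

Definition lightlike_curve_on (a b : R) (al : R -> V4) : Prop :=
  smooth_curve_on a b al /\ forall t, a < t < b -> lightlike (velocity al t).

Definition in_hyperplane_orth_on (a b : R) (al : R -> V4) (N : V4) : Prop :=
  exists c, forall t, a < t < b -> mink (al t) N = c.

Definition locally_sum_of_lightlike (U : R -> R -> Prop) (f g : R -> R -> R)
  : Prop :=
  forall x0 y0, U x0 y0 -> exists del, 0 < del /\
    (forall x y, Rabs (x - x0) < del -> Rabs (y - y0) < del -> U x y) /\
    exists al be : R -> V4,
      lightlike_curve_on (x0 - del) (x0 + del) al /\
      lightlike_curve_on (y0 - del) (y0 + del) be /\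
      in_hyperplane_orth_on (x0 - del) (x0 + del) al e4 /\
      in_hyperplane_orth_on (y0 - del) (y0 + del) be e3 /\
      forall x y, Rabs (x - x0) < del -> Rabs (y - y0) < del ->
        psi f g x y = vadd (al x) (be y).

(* Main.v *)
Require Import Defs.
From Stdlib Require Import Reals Lra List ClassicalEpsilon.
Open Scope R_scope.

(** Testing the null direction condition on [e3] and [e4] gives [G / det = 0] and
    [E / det = 0], so [x] and [y] are null coordinates and [H = psi_xy^perp / F].
    The last two components of [psi_xy] vanish, whereas [psi_x] and [psi_y] end in
    [(1,0)] and [(0,1)]; hence [psi_xy] is tangent only if it is zero. Thus [M] is
    minimal iff [f_xy = g_xy = 0], that is, iff [psi] locally splits as a sum of a
    curve in [x] and a curve in [y]. *)

(** * Derivative values and smoothness on an open set *)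

Lemma epsilon_derivable_pt_lim (h : R -> R) (x l : R) :
  derivable_pt_lim h x l ->
  epsilon (inhabits 0) (fun l => derivable_pt_lim h x l) = l.
Proof.
  intros H. apply (uniqueness_limite h x); [|exact H].
  apply (epsilon_spec (inhabits 0) (fun l => derivable_pt_lim h x l)).
  now exists l.
Qed.

Lemma dx_eq (h : R -> R -> R) (x y l : R) :
  derivable_pt_lim (fun t => h t y) x l -> dx h x y = l.
Proof. apply epsilon_derivable_pt_lim. Qed.

Lemma dy_eq (h : R -> R -> R) (x y l : R) :
  derivable_pt_lim (fun t => h x t) y l -> dy h x y = l.
Proof. apply epsilon_derivable_pt_lim. Qed.

Lemma d1_eq (h : R -> R) (t l : R) : derivable_pt_lim h t l -> Defs.d1 h t = l.
Proof. apply epsilon_derivable_pt_lim. Qed.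

(** Differentiability is local. This matters because the family in [smooth2] has [D nil] equal to
    [h] only on [U]. *)
Lemma derivable_pt_lim_near (h k : R -> R) (x l eps : R) :
  0 < eps -> (forall t, Rabs (t - x) < eps -> h t = k t) ->
  derivable_pt_lim h x l -> derivable_pt_lim k x l.
Proof.
  intros Heps Heq. apply derivable_pt_lim_locally_ext with (x - eps) (x + eps).
  - lra.
  - intros t Ht. apply Heq, Rabs_def1; lra.
Qed.

Lemma derivable_pt_lim_zero_eq (h : R -> R) (a b s t : R) :
  (forall u, a < u < b -> derivable_pt_lim h u 0) ->
  a < s < b -> a < t < b -> h s = h t.
Proof.
  intros H.
  assert (Hlt : forall s t, a < s < b -> a < t < b -> s < t -> h s = h t).
  { intros s' t' Hs Ht Hst.
    destruct (MVT_cor2 h (fun _ => 0) s' t' Hst) as [c [Hc _]]; [|lra].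
    intros c Hc. apply H. lra. }
  intros Hs Ht. destruct (Rtotal_order s t) as [L | [-> | L]].
  - now apply Hlt.
  - reflexivity.
  - symmetry. now apply Hlt.
Qed.

Lemma smooth2_derivable_dx (U : R -> R -> Prop) (h : R -> R -> R) (x y : R) :
  open2 U -> smooth2 U h -> U x y ->
  derivable_pt_lim (fun t => h t y) x (dx h x y).
Proof.
  intros HU [D [D0 HD]] Hxy.
  assert (H : derivable_pt_lim (fun t => h t y) x (D (true :: nil) x y)).
  { destruct (HU x y Hxy) as [eps [Heps Hball]].
    apply (derivable_pt_lim_near (fun t => D nil t y) _ x _ eps Heps).
    - intros t Ht. apply D0, Hball; [exact Ht|].
      rewrite Rminus_diag, Rabs_R0. exact Heps.
    - now apply (HD nil). }
  (* The witness of smoothness supplies existence; uniqueness of the limit identifies it with the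
     chosen value [dx h x y]. *)
  rewrite (dx_eq _ _ _ _ H). exact H.
Qed.

Lemma smooth2_derivable_dy (U : R -> R -> Prop) (h : R -> R -> R) (x y : R) :
  open2 U -> smooth2 U h -> U x y ->
  derivable_pt_lim (fun t => h x t) y (dy h x y).
Proof.
  intros HU [D [D0 HD]] Hxy.
  assert (H : derivable_pt_lim (fun t => h x t) y (D (false :: nil) x y)).
  { destruct (HU x y Hxy) as [eps [Heps Hball]].
    apply (derivable_pt_lim_near (fun t => D nil x t) _ y _ eps Heps).
    - intros t Ht. apply D0, Hball; [|exact Ht].
      rewrite Rminus_diag, Rabs_R0. exact Heps.
    - now apply (HD nil). }
  rewrite (dy_eq _ _ _ _ H). exact H.
Qed.

(** Words act from right to left, so appending [b] on the right differentiates along [b] first: the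
    derivatives of [h] are a re-indexed subfamily of [D]. *)
Lemma smooth2_shift (U : R -> R -> Prop) (h : R -> R -> R)
    (D : list bool -> R -> R -> R) (b : bool) :
  (forall x y, U x y -> h x y = D (b :: nil) x y) ->
  (forall w, cont2_on U (D w) /\
    forall x y, U x y ->
      derivable_pt_lim (fun t => D w t y) x (D (true :: w) x y) /\
      derivable_pt_lim (fun t => D w x t) y (D (false :: w) x y)) ->
  smooth2 U h.
Proof.
  intros Hh HD. exists (fun w => D (w ++ b :: nil)%list). split.
  - intros x y Hxy. symmetry. now apply Hh.
  - intros w. apply (HD (w ++ b :: nil)%list).
Qed.

Lemma smooth2_dx (U : R -> R -> Prop) (h : R -> R -> R) :
  open2 U -> smooth2 U h -> smooth2 U (dx h).
Proof.
  intros HU Hh. pose proof Hh as [D [D0 HD]].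
  apply (smooth2_shift U _ D true); [|exact HD].
  intros x y Hxy. apply dx_eq. destruct (HU x y Hxy) as [eps [Heps Hball]].
  apply (derivable_pt_lim_near (fun t => D nil t y) _ x _ eps Heps).
  - intros t Ht. apply D0, Hball; [exact Ht|].
    rewrite Rminus_diag, Rabs_R0. exact Heps.
  - now apply (HD nil).
Qed.

Lemma smooth2_dy (U : R -> R -> Prop) (h : R -> R -> R) :
  open2 U -> smooth2 U h -> smooth2 U (dy h).
Proof.
  intros HU Hh. pose proof Hh as [D [D0 HD]].
  apply (smooth2_shift U _ D false); [|exact HD].
  intros x y Hxy. apply dy_eq. destruct (HU x y Hxy) as [eps [Heps Hball]].
  apply (derivable_pt_lim_near (fun t => D nil x t) _ y _ eps Heps).
  - intros t Ht. apply D0, Hball; [|exact Ht].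
    rewrite Rminus_diag, Rabs_R0. exact Heps.
  - now apply (HD nil).
Qed.

(** * Smooth functions of one variable obtained from slices *)

Lemma smooth1_on_slice_x (U : R -> R -> Prop) (h : R -> R -> R) (a b y : R) :
  open2 U -> smooth2 U h -> (forall t, a < t < b -> U t y) ->
  smooth1_on a b (fun t => h t y).
Proof.
  intros HU Hh Hab. exists (fun n t => Nat.iter n dx h t y).
  split; [reflexivity|]. intros n t Ht.
  apply (smooth2_derivable_dx U); auto.
  induction n; [exact Hh | now apply smooth2_dx].
Qed.

Lemma smooth1_on_slice_y (U : R -> R -> Prop) (h : R -> R -> R) (a b x : R) :
  open2 U -> smooth2 U h -> (forall t, a < t < b -> U x t) ->
  smooth1_on a b (fun t => h x t).
Proof.
  intros HU Hh Hab. exists (fun n t => Nat.iter n dy h x t).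
  split; [reflexivity|]. intros n t Ht.
  apply (smooth2_derivable_dy U); auto.
  induction n; [exact Hh | now apply smooth2_dy].
Qed.

Lemma derivable_pt_lim_minus_const (h : R -> R) (k t l : R) :
  derivable_pt_lim h t l -> derivable_pt_lim (fun s => h s - k) t l.
Proof.
  intros H. replace l with (l - 0) by ring.
  apply (derivable_pt_lim_minus h (fun _ => k)); [exact H|].
  apply derivable_pt_lim_const.
Qed.

Lemma smooth1_on_minus_const (a b k : R) (h : R -> R) :
  smooth1_on a b h -> smooth1_on a b (fun t => h t - k).
Proof.
  intros [D [D0 HD]].
  (* Subtracting a constant changes only the derivative of order zero. *)
  exists (fun n => match n with O => fun t => D O t - k | S _ => D n end). split.
  - intros t Ht. now rewrite D0.
  - intros [|n] t Ht; [apply derivable_pt_lim_minus_const|]; now apply HD.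
Qed.

Lemma smooth1_on_const (a b k : R) : smooth1_on a b (fun _ => k).
Proof.
  exists (fun n _ => match n with O => k | S _ => 0 end). split; [reflexivity|].
  intros n t _. apply derivable_pt_lim_const.
Qed.

Lemma smooth1_on_id (a b : R) : smooth1_on a b (fun t => t).
Proof.
  exists (fun n t => match n with O => t | S O => 1 | _ => 0 end).
  split; [reflexivity|].
  intros [|[|n]] t _;
    [apply derivable_pt_lim_id | apply derivable_pt_lim_const
    | apply derivable_pt_lim_const].
Qed.

(** * Vanishing mixed partial derivative and additive splitting *)

Lemma mixed_partial_zero_split (U : R -> R -> Prop) (h : R -> R -> R)
    (x0 y0 del x y : R) :
  open2 U -> smooth2 U h ->
  (forall x y, Rabs (x - x0) < del -> Rabs (y - y0) < del -> U x y) ->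
  (forall x y, U x y -> dx (dy h) x y = 0) ->
  Rabs (x - x0) < del -> Rabs (y - y0) < del ->
  h x y = h x y0 + (h x0 y - h x0 y0).
Proof.
  intros HU Hh Hsq Hzero Hx Hy.
  assert (Hdel : 0 < del) by (pose proof (Rabs_pos (x - x0)); lra).
  assert (Hin : forall s s0, s0 - del < s < s0 + del -> Rabs (s - s0) < del)
    by (intros; apply Rabs_def1; lra).
  apply Rabs_def2 in Hx, Hy.
  (* First integration, along [x]: [dy h] has zero [x]-derivative on the square. *)
  assert (Hdy : forall t, y0 - del < t < y0 + del -> dy h x t = dy h x0 t).
  { intros t Ht.
    apply (derivable_pt_lim_zero_eq (fun s => dy h s t) (x0 - del) (x0 + del));
      try lra.
    intros u Hu. assert (Hut : U u t) by auto.
    rewrite <- (Hzero u t Hut).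
    apply (smooth2_derivable_dx U); auto using smooth2_dy. }
  (* Second integration, along [y]: the difference of two vertical slices has zero derivative, hence
     equals its value at [y0]. *)
  enough (h x y - h x0 y = h x y0 - h x0 y0) by lra.
  apply (derivable_pt_lim_zero_eq (fun t => h x t - h x0 t)
           (y0 - del) (y0 + del)); try lra.
  intros t Ht. replace 0 with (dy h x t - dy h x0 t) by (rewrite Hdy; lra).
  apply (derivable_pt_lim_minus (fun t => h x t) (fun t => h x0 t));
    apply (smooth2_derivable_dy U); auto; apply Hsq; apply Hin; lra.
Qed.

(** The functions [a] and [b] need not be differentiable, so the argument compares slices of [h]:
    those at [t] and [x0] differ by the constant [a x0 - a t]. Hence [dy h] at height [y0] is
    constant in [x] near [x0]. *)
Lemma split_mixed_partial_zero (U : R -> R -> Prop) (h : R -> R -> R)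
    (a b : R -> R) (x0 y0 del : R) :
  open2 U -> smooth2 U h -> 0 < del ->
  (forall x y, Rabs (x - x0) < del -> Rabs (y - y0) < del -> U x y) ->
  (forall x y, Rabs (x - x0) < del -> Rabs (y - y0) < del ->
    h x y = a x + b y) ->
  dx (dy h) x0 y0 = 0.
Proof.
  intros HU Hh Hdel Hsq Hsum. apply dx_eq.
  assert (H0 : forall s, Rabs (s - s) < del)
    by (intros; rewrite Rminus_diag, Rabs_R0; exact Hdel).
  apply (derivable_pt_lim_near (fun _ => dy h x0 y0) _ x0 0 del Hdel).
  - intros t Ht. symmetry. apply dy_eq.
    apply (derivable_pt_lim_near (fun s => h x0 s - (a x0 - a t)) _ y0 _ del Hdel).
    + intros s Hs. rewrite !Hsum by auto. ring.
    + apply derivable_pt_lim_minus_const.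
      apply (smooth2_derivable_dy U); auto.
  - apply derivable_pt_lim_const.
Qed.

(** * Tangent frame of the graph and the null conditions *)

Lemma dx_fst (x y : R) : dx (fun a _ => a) x y = 1.
Proof. apply dx_eq, derivable_pt_lim_id. Qed.

Lemma dx_snd (x y : R) : dx (fun _ b => b) x y = 0.
Proof. apply dx_eq, derivable_pt_lim_const. Qed.

Lemma dy_fst (x y : R) : dy (fun a _ => a) x y = 0.
Proof. apply dy_eq, derivable_pt_lim_const. Qed.

Lemma dy_snd (x y : R) : dy (fun _ b => b) x y = 1.
Proof. apply dy_eq, derivable_pt_lim_id. Qed.

Lemma psixE (f g : R -> R -> R) (x y : R) :
  psix f g x y = mkV4 (dx f x y) (dx g x y) 1 0.
Proof.
  unfold psix, dxv, psi; simpl. rewrite dx_fst, dx_snd. reflexivity.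
Qed.

Lemma psiyE (f g : R -> R -> R) (x y : R) :
  psiy f g x y = mkV4 (dy f x y) (dy g x y) 0 1.
Proof.
  unfold psiy, dyv, psi; simpl. rewrite dy_fst, dy_snd. reflexivity.
Qed.

Lemma psixyE (f g : R -> R -> R) (x y : R) :
  psixy f g x y = mkV4 (dx (dy f) x y) (dx (dy g) x y) 0 0.
Proof.
  (* The last two entries of [dyv] are chosen values, known only pointwise to be the constants 0 and
     1. *)
  assert (H : forall (h : R -> R -> R) k, (forall a b, h a b = k) -> dx h x y = 0).
  { intros h k Hk. apply dx_eq.
    apply (derivable_pt_lim_near (fun _ => k) _ x 0 1 Rlt_0_1).
    - intros t _. now rewrite Hk.
    - apply derivable_pt_lim_const. }
  unfold psixy, dxv, dyv, psi; simpl. f_equal.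
  - apply (H _ 0). apply dy_fst.
  - apply (H _ 1). apply dy_snd.
Qed.

(** The coefficients of [tproj] come from the inverse metric, so the squared length is the inverse
    metric evaluated on the pairings of [Z] with the tangent frame. *)
Lemma mink_tproj (f g : R -> R -> R) (Z : V4) (x y : R) :
  detI f g x y <> 0 ->
  mink (tproj f g Z x y) (tproj f g Z x y) =
  (GG f g x y * (mink Z (psix f g x y)) ^ 2
   - 2 * FF f g x y * mink Z (psix f g x y) * mink Z (psiy f g x y)
   + EE f g x y * (mink Z (psiy f g x y)) ^ 2) / detI f g x y.
Proof.
  assert (Hbil : forall a b u v,
    mink (vadd (vscal a u) (vscal b v)) (vadd (vscal a u) (vscal b v)) =
    a ^ 2 * mink u u + 2 * a * b * mink u v + b ^ 2 * mink v v)
    by (intros; unfold mink, vadd, vscal; simpl; ring).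
  intros Hdet. unfold tproj. cbv zeta. rewrite Hbil.
  fold (EE f g x y) (FF f g x y) (GG f g x y).
  unfold detI in *. field. exact Hdet.
Qed.

(** The pairings of [e3] with the frame are 1 and 0, which reduces the squared length of its tangent
    part to [GG / detI]. *)
Lemma canonical_null_e3_GG (U : R -> R -> Prop) (f g : R -> R -> R) (x y : R) :
  timelike_graph U f g -> canonical_null_dir U f g e3 -> U x y ->
  GG f g x y = 0.
Proof.
  intros Ht Hn Hxy. specialize (Ht x y Hxy). destruct (Hn x y Hxy) as [_ H].
  rewrite mink_tproj in H by lra.
  replace (mink e3 (psix f g x y)) with 1 in H
    by (rewrite psixE; unfold mink, e3; simpl; ring).
  replace (mink e3 (psiy f g x y)) with 0 in H
    by (rewrite psiyE; unfold mink, e3; simpl; ring).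
  apply (Rmult_eq_compat_r (detI f g x y)) in H. field_simplify in H; lra.
Qed.

Lemma canonical_null_e4_EE (U : R -> R -> Prop) (f g : R -> R -> R) (x y : R) :
  timelike_graph U f g -> canonical_null_dir U f g e4 -> U x y ->
  EE f g x y = 0.
Proof.
  intros Ht Hn Hxy. specialize (Ht x y Hxy). destruct (Hn x y Hxy) as [_ H].
  rewrite mink_tproj in H by lra.
  replace (mink e4 (psix f g x y)) with 0 in H
    by (rewrite psixE; unfold mink, e4; simpl; ring).
  replace (mink e4 (psiy f g x y)) with 1 in H
    by (rewrite psiyE; unfold mink, e4; simpl; ring).
  apply (Rmult_eq_compat_r (detI f g x y)) in H. field_simplify in H; lra.
Qed.

(** * Mean curvature in null coordinates *)

Lemma meanH_null_coordinates (f g : R -> R -> R) (x y : R) :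
  EE f g x y = 0 -> GG f g x y = 0 -> detI f g x y < 0 ->
  meanH f g x y = vscal (/ FF f g x y) (nproj f g (psixy f g x y) x y).
Proof.
  intros HE HG Hdet.
  assert (HF : FF f g x y <> 0)
    by (intros HF; unfold detI in Hdet; rewrite HE, HF in Hdet; lra).
  (* Only the mixed term of the trace survives, and its coefficient [- FF / detI] becomes [/ FF]. *)
  assert (Hc : detI f g x y = - (FF f g x y * FF f g x y))
    by (unfold detI; rewrite HE; ring).
  unfold meanH. rewrite HE, HG, Hc.
  generalize (nproj f g (psixx f g x y) x y) (nproj f g (psixy f g x y) x y)
    (nproj f g (psiyy f g x y) x y); intros u v w.
  unfold vadd, vscal; simpl. f_equal; field; exact HF.
Qed.

Lemma meanH_zero_iff (f g : R -> R -> R) (x y : R) :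
  EE f g x y = 0 -> GG f g x y = 0 -> detI f g x y < 0 ->
  (meanH f g x y = vzero <-> dx (dy f) x y = 0 /\ dx (dy g) x y = 0).
Proof.
  intros HE HG Hdet. rewrite meanH_null_coordinates by assumption.
  assert (HF : FF f g x y <> 0)
    by (intros HF; unfold detI in Hdet; rewrite HE, HF in Hdet; lra).
  split.
  - intros H.
    assert (Hn : nproj f g (psixy f g x y) x y = vzero).
    { destruct (nproj f g (psixy f g x y) x y) as [a b c d].
      unfold vscal, vzero in *; simpl in H. injection H as H1 H2 H3 H4.
      assert (Hi := Rinv_neq_0_compat _ HF).
      apply Rmult_integral in H1, H2, H3, H4.
      f_equal; tauto. }
    unfold nproj, tproj in Hn. cbv zeta in Hn.
    revert Hn.
    (* The tangential coefficients become arbitrary scalars [a] and [b]: the last two components of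
       the vanishing normal part read [- a = 0] and [- b = 0], and the first two then give the
       claim. *)
    match goal with
    | |- vsub _ (vadd (vscal ?p _) (vscal ?q _)) = _ -> _ =>
        generalize p q; intros a b
    end.
    rewrite psixyE, psixE, psiyE. unfold vsub, vadd, vscal, vzero; simpl.
    intros Hn. injection Hn as H1 H2 H3 H4.
    assert (Ha : a = 0) by lra. assert (Hb : b = 0) by lra. subst a b.
    split; lra.
  - intros [Hf Hg].
    assert (Hxy : psixy f g x y = vzero) by (rewrite psixyE, Hf, Hg; reflexivity).
    rewrite Hxy. unfold nproj, tproj.
    replace (mink vzero (psix f g x y)) with 0
      by (unfold mink, vzero; simpl; ring).
    replace (mink vzero (psiy f g x y)) with 0
      by (unfold mink, vzero; simpl; ring).
    unfold Rdiv, vsub, vadd, vscal, vzero; simpl. f_equal; ring.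
Qed.

(** * Minimality and the splitting into lightlike curves *)

Theorem mainTheorem17 (U : R -> R -> Prop) (f g : R -> R -> R) :
  open2 U -> smooth2 U f -> smooth2 U g ->
  timelike_graph U f g ->
  canonical_null_dir U f g e3 -> canonical_null_dir U f g e4 ->
  (minimal U f g <-> locally_sum_of_lightlike U f g).
Proof.
  intros HU Hf Hg Ht H3 H4.
  assert (HG : forall x y, U x y -> GG f g x y = 0)
    by (intros; eapply canonical_null_e3_GG; eauto).
  assert (HE : forall x y, U x y -> EE f g x y = 0)
    by (intros; eapply canonical_null_e4_EE; eauto).
  split.
  - intros Hmin.
    assert (Hmix : forall x y, U x y -> dx (dy f) x y = 0 /\ dx (dy g) x y = 0)
      by (intros x y Hxy; apply meanH_zero_iff; auto).
    intros x0 y0 H0. destruct (HU x0 y0 H0) as [del [Hdel Hsq]].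
    exists del. split; [exact Hdel|]. split; [exact Hsq|].
    assert (Hx : forall t, x0 - del < t < x0 + del -> U t y0)
      by (intros; apply Hsq; apply Rabs_def1; lra).
    assert (Hy : forall t, y0 - del < t < y0 + del -> U x0 t)
      by (intros; apply Hsq; apply Rabs_def1; lra).
    (* The curves are the two coordinate slices through the base point; [f x0 y0] and [g x0 y0] are
       subtracted from the second so that they are not counted twice. *)
    exists (fun t => mkV4 (f t y0) (g t y0) t 0),
      (fun t => mkV4 (f x0 t - f x0 y0) (g x0 t - g x0 y0) 0 t).
    split; [split|split; [split|split; [|split]]].
    + unfold smooth_curve_on; simpl. repeat split;
        [apply (smooth1_on_slice_x U); auto | apply (smooth1_on_slice_x U); auto
        | apply smooth1_on_id | apply smooth1_on_const].
    + intros t Hin.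
      (* The velocity is a coordinate tangent vector: null since [EE] vanishes, nonzero since its
         third component is 1. *)
      replace (velocity _ t) with (psix f g t y0).
      * split; [|apply HE; auto].
        rewrite psixE. unfold vzero. intros E. apply (f_equal c3) in E; simpl in E; lra.
      (* In the first two components [d1] of the slice and [dx] are the same choice by definition,
         so only the last two remain. *)
      * rewrite psixE. unfold velocity; simpl. symmetry. f_equal; apply d1_eq;
          [apply derivable_pt_lim_id | apply derivable_pt_lim_const].
    + unfold smooth_curve_on; simpl. repeat split;
        [apply smooth1_on_minus_const, (smooth1_on_slice_y U); auto
        | apply smooth1_on_minus_const, (smooth1_on_slice_y U); auto
        | apply smooth1_on_const | apply smooth1_on_id].
    + intros t Hin.
      replace (velocity _ t) with (psiy f g x0 t).
      * split; [|apply HG; auto].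
        rewrite psiyE. unfold vzero. intros E. apply (f_equal c4) in E; simpl in E; lra.
      * rewrite psiyE. unfold velocity; simpl. symmetry. f_equal; apply d1_eq;
          [apply derivable_pt_lim_minus_const, (smooth2_derivable_dy U); auto
          | apply derivable_pt_lim_minus_const, (smooth2_derivable_dy U); auto
          | apply derivable_pt_lim_const | apply derivable_pt_lim_id].
    + exists 0. intros t _. unfold mink, e4; simpl. ring.
    + exists 0. intros t _. unfold mink, e3; simpl. ring.
    + intros x y Hxd Hyd. unfold psi, vadd; simpl. f_equal; try ring;
        apply (mixed_partial_zero_split U _ x0 y0 del); auto; apply Hmix.
  - intros Hloc x y Hxy. apply meanH_zero_iff; auto.
    destruct (Hloc x y Hxy)
      as [del [Hdel [Hsq [al [be [_ [_ [_ [_ Hsum]]]]]]]]].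
    (* The first two components of the sum formula split [f] and [g] on a square centred at the
       given point. *)
    split;
      [apply (split_mixed_partial_zero U f (fun t => Defs.c1 (al t)) (fun t => Defs.c1 (be t))
                x y del)
      |apply (split_mixed_partial_zero U g (fun t => c2 (al t)) (fun t => c2 (be t))
                x y del)]; auto;
      intros s t Hs Hst; specialize (Hsum s t Hs Hst);
      unfold psi, vadd in Hsum; now injection Hsum.
Qed.
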